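(* Let $\lambda$ be a regular uncountable cardinal. Assume that $\lambda$ is not Mahlo, or that $\lambda$ is Mahlo and satisfies $\otimes^{\aleph_0}_\lambda$ or $\oplus^{\aleph_0}_\lambda$ (defined in the context). Then $\Pr_7(\lambda,\aleph_0,\aleph_0)$ holds; that is, there is $c:[\lambda]^2\to\omega$ such that (1) for every $A\in[\lambda]^\lambda$ and $n<\omega$ there is $B\in[A]^\lambda$ with $\min \mathrm{Rang}(c\restriction[B]^2)>n$; and moreover (2) if $w_\alpha$ ($\alpha<\lambda$) are pairwise disjoint finite subsets of $\lambda$ and $n<\omega$, then there is $X\in[\lambda]^\lambda$ such that for all $\alpha<\beta$ from $X$, all $i\in w_\alpha$ and all $j\in w_\beta$, $c\{i,j\}\ge n$.
   Context: $[A]^\lambda$ is the family of subsets of $A$ of cardinality $\lambda$; $[A]^2$ is the family of two-element subsets. For a set $C$ of ordinals, $\mathrm{acc}(C)=\{\alpha\in C:\alpha=\sup(\alpha\cap C)\}$ and $\mathrm{nacc}(C)=C\setminus\mathrm{acc}(C)$. ''Inaccessible'' means weakly inaccessible (uncountable regular limit cardinal); $\lambda$ is Mahlo if it is inaccessible and the set of inaccessibles below $\lambda$ is stationary in $\lambda$. Put $S^\lambda_{\mathrm{in}}=\{\delta<\lambda:\delta\text{ is inaccessible}\}$ and $S^\lambda_{\ge\kappa}=\{\delta<\lambda:\mathrm{cf}(\delta)\ge\kappa\}$. $\otimes^\kappa_\lambda$ (for $\lambda$ Mahlo, $\kappa<\lambda$): there is $\bar C=\langle C_\delta:\delta\in S^\lambda_{\mathrm{in}}\rangle$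 with each $C_\delta$ a club of $\delta$, such that for every club $E$ of $\lambda$ there is $\delta\in\mathrm{acc}(E)\cap S^\lambda_{\mathrm{in}}$ with $\mathrm{cf}(\delta)\ge\kappa$ such that for no $\zeta<\kappa$ and $\alpha_\varepsilon\in S^\lambda_{\mathrm{in}}$ ($\varepsilon<\zeta$) is $(\mathrm{nacc}(E)\cap\delta)\setminus\bigcup_{\varepsilon<\zeta}C_{\alpha_\varepsilon}$ bounded in $\delta$. $\oplus^\kappa_\lambda$ (for $\lambda$ regular uncountable, $\kappa<\lambda$): there is $\bar C=\langle C_\delta:\delta\in S\rangle$, where $S=\{\delta<\lambda:\delta\text{ a limit ordinal}\}$ and each $C_\delta$ is a club of $\delta$, such that for every club $E$ of $\lambda$ there is $\delta\in\mathrm{acc}(E)$ with $\mathrm{cf}(\delta)\ge\kappa$ such that for no $\zeta<\kappa$ and $\alpha_\varepsilon\in S$ ($\varepsilon<\zeta$) is $(S^\lambda_{\ge\kappa}\cap E\cap\delta)\setminus\bigcup_{\varepsilon<\zeta}C_{\alpha_\varepsilon}$ bounded in $\delta$. *)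

(* Defs.v *)
From HB Require Import structures.
From mathcomp Require Import all_boot all_order.
From mathcomp Require Import boolp wochoice classical_sets functions cardinality.

Set Implicit Arguments.
Unset Strict Implicit.
Unset Printing Implicit Defensive.

Import Order.TTheory.
Local Open Scope classical_set_scope.
Local Open Scope card_scope.

(* The cardinal lambda is a well-ordered type [L], regular in the sense of
   [regular_cardinal [set: L]] (hence an initial ordinal).  As with von Neumann
   ordinals, an ordinal <= lambda is the set of its predecessors: an ordinal
   delta < lambda is the initial segment [below delta] of a point [delta : L],
   and lambda itself is [[set: L]].  Below, [D] and [kappa] stand for such
   initial segments, and [kappa `<=` D], [kappa zeta] express kappa <= D and
   zeta < kappa. *)

Section Ordinals.
Context {d : Order.disp_t} {L : orderType d}.
Implicit Types (A C D E S kappa : set L) (alpha delta : L).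

Definition below delta : set L := [set x | (x < delta)%O].

Definition limit_ordinal alpha :=
  below alpha !=set0 /\
  forall beta, (beta < alpha)%O -> exists gamma, (beta < gamma < alpha)%O.

Definition bounded_in A D := exists2 beta, D beta & A `<=` below beta.

Definition unbounded_in A D := A `<=` D /\ ~ bounded_in A D.

(* The initial ordinal {x : |x| < |A|} equipotent with A. *)
Definition card A : set L := [set x | ~~ (A #<= below x)].

(* A minimum of ordinals is their intersection, so this is the least
   cardinality of an unbounded subset of D. *)
Definition cf D : set L := \bigcap_(A in [set A | unbounded_in A D]) card A.

Definition is_cardinal D := card D = D.

Definition regular_cardinal D :=
  [/\ infinite_set D, is_cardinal D & cf D = D].

Definition limit_cardinal D :=
  is_cardinal D /\
  forall mu, D mu -> is_cardinal (below mu) ->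
    exists nu, [/\ D nu, is_cardinal (below nu) & (mu < nu)%O].

Definition inaccessible D :=
  [/\ ~ countable D, regular_cardinal D & limit_cardinal D].

(* With sup of the empty set equal to 0, the ordinal 0 belongs to acc C as soon
   as it belongs to C. *)
Definition acc C : set L := [set alpha | C alpha /\ isLub (below alpha `&` C) alpha].

Definition nacc C : set L := C `\` acc C.

Definition club C D :=
  unbounded_in C D /\
  forall alpha, D alpha -> limit_ordinal alpha ->
    isLub (below alpha `&` C) alpha -> C alpha.

Definition stationary S D := forall C, club C D -> S `&` C !=set0.

End Ordinals.

Section Principles.
Context {d : Order.disp_t} (L : orderType d).
Implicit Types (kappa E : set L).

(* omega = aleph_0, as an initial segment of L *)
Definition omega : set L := [set x | finite_set (below x)].

Definition S_in : set L := [set delta | inaccessible (below delta)].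

Definition S_ge kappa : set L := [set delta | kappa `<=` cf (below delta)].

Definition S_lim : set L := [set delta | limit_ordinal delta].

Definition Mahlo := inaccessible [set: L] /\ stationary S_in [set: L].

Definition otimes kappa :=
  exists C : L -> set L,
    (forall delta, S_in delta -> club (C delta) (below delta)) /\
    forall E, club E [set: L] ->
      exists delta, [/\ acc E delta, S_in delta, S_ge kappa delta &
        ~ exists zeta : L, exists alpha : L -> L,
          [/\ kappa zeta,
              forall eps, (eps < zeta)%O -> S_in (alpha eps) &
              bounded_in ((nacc E `&` below delta) `\`
                          \bigcup_(eps in below zeta) C (alpha eps))
                         (below delta)]].

Definition oplus kappa :=
  exists C : L -> set L,
    (forall delta, S_lim delta -> club (C delta) (below delta)) /\
    forall E, club E [set: L] ->
      exists delta, [/\ acc E delta, S_ge kappa delta &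
        ~ exists zeta : L, exists alpha : L -> L,
          [/\ kappa zeta,
              forall eps, (eps < zeta)%O -> S_lim (alpha eps) &
              bounded_in ((S_ge kappa `&` E `&` below delta) `\`
                          \bigcup_(eps in below zeta) C (alpha eps))
                         (below delta)]].

End Principles.

Arguments omega {d} L _.
Arguments S_in {d} L _.
Arguments S_lim {d} L _.

(* [A]^K, where the cardinal K is given by any set of that cardinality.  A
   colouring of [lambda]^2 is a function on all of [set L], of which only the
   values at two-element sets matter. *)
Definition subsets_of_card (T U : Type) (A : set T) (K : set U) : set (set T) :=
  [set B | B `<=` A /\ B #= K].

Definition is_min (A : set nat) (m : nat) := A m /\ forall k, A k -> m <= k.

(* Main.v *)
(* The colour of {a < b} is the length of Todorcevic's walk from b down to a
   along a C-sequence C.  If the walk from b to a limit x needs more than n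
   steps, so do the walks to all targets just below x; by pressing down, a
   family of finite sets that is far from stationarily many x is far from a
   whole tail [e, x[ of targets, uniformly in unboundedly many x.  Suppose that
   for every club E some limit point x of E is such that no tail of E below x is
   covered by finitely many of the C_z, z > x.  For such an x above e,
   cofinally many points of E below x avoid the C_z through which the walks to x
   enter x, so the walks to these points are one step longer than the walks to
   x; hence walks get arbitrarily long by induction.

   Under oplus the guessing sequence is such a C; under otimes it is extended to
   the limits that are not inaccessible by clubs without inaccessible limit
   points.  If lambda is not Mahlo, some club consists of singular points, where
   C_z can be chosen of order type cf z < min C_z; then finitely many C_z are too
   small to cover a tail of E below a sufficiently closed x. *)

Require Import Defs.
From HB Require Import structures.
From mathcomp Require Import all_boot all_order.
From mathcomp Require Import boolp wochoice classical_sets functions cardinality.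

Set Implicit Arguments.
Unset Strict Implicit.
Unset Printing Implicit Defensive.

Import Order.TTheory.
Local Open Scope classical_set_scope.
Local Open Scope card_scope.

(** * Preliminaries on cardinalities and well-orders *)

Lemma cover_card_le (T U : Type) (A : set T) (B : set U) (g : U -> T) :
  A `<=` g @` B -> A #<= B.
Proof. by move=> /subset_card_le /card_le_trans; apply; exact: card_image_le. Qed.

Lemma card_le_cover (T U : Type) (A : set T) (B : set U) :
  T -> A #<= B -> exists g : U -> T, A `<=` g @` B.
Proof.
move=> t /pfcard_geP[->|[f]]; first by exists (fun=> t) => x.
by exists f => x /'surj_f.
Qed.

Section WellOrder.
Context {d : Order.disp_t} {L : orderType d}.
Context (L_wo : well_order (<=%O : rel L)).
Local Open Scope order_scope.
Implicit Types (A C D E P : set L) (h g f : L -> L) (x y z : L).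

Lemma least_exists P : P !=set0 -> exists m, P m /\ forall y, P y -> m <= y.
Proof.
move=> [x Px].
have /L_wo[m [[mP min_m] _]] : wochoice.nonempty [pred x | `[< P x >]].
  by exists x; apply/asboolP.
exists m; split=> [|y Py]; first exact/asboolP.
by apply: min_m; apply/asboolP.
Qed.

Lemma lt_wf : well_founded (fun x y => x < y).
Proof.
move=> x; apply: contrapT => nx.
have [m [nm minm]] : exists m, ~ Acc (fun x y => x < y) m /\
   forall y, ~ Acc (fun x y => x < y) y -> m <= y by apply: least_exists; exists x.
apply: nm; constructor => y; rewrite ltNge => ylt.
by apply: contrapT => /minm; apply/negP.
Qed.

(** At limit points this is the [isLub] condition of [acc] and [club]; its negation gives a gap of
    [A] just below [x]. *)
Definition cofinal_in A x := forall y, y < x -> exists2 z, A z & y <= z < x.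

Lemma limit_lt x y : limit_ordinal x -> y < x -> exists2 z, y < z & z < x.
Proof. by move=> [_ xl] /xl[z /andP[? ?]]; exists z. Qed.

Lemma cofinal_in_lt A x y : limit_ordinal x -> cofinal_in A x -> y < x ->
  exists z, [/\ A z, y < z & z < x].
Proof.
move=> xl cA yx; have [z yz zx] := limit_lt xl yx.
have [u Au /andP[zu ux]] := cA _ zx.
by exists u; split=> //; apply: lt_le_trans zu.
Qed.

Lemma cofinal_isLub A x : limit_ordinal x ->
  isLub (below x `&` A) x <-> cofinal_in A x.
Proof.
move=> xl; split=> [[_ lub] y yx|cA].
  apply: contrapT => none; suff /lub : ubound (below x `&` A) y by rewrite leNgt yx.
  move=> z [/= zx Az]; rewrite leNgt; apply/negP => yz; apply: none.
  by exists z => //; rewrite ltW.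
split=> [y [/ltW]//|b ubb]; rewrite leNgt; apply/negP => bx.
have [z [Az bz zx]] := cofinal_in_lt xl cA bx.
by have := ubb z; rewrite leNgt bz => /(_ (conj zx Az)).
Qed.

Lemma unbounded_belowP A x : limit_ordinal x ->
  unbounded_in A (below x) <-> A `<=` below x /\ cofinal_in A x.
Proof.
move=> xl; split=> [[sA nb]|[sA cA]]; split=> //.
  move=> y yx; apply: contrapT => none; apply: nb; exists y => // z Az.
  rewrite /below /= ltNge; apply/negP => yz; apply: none.
  by exists z => //; rewrite yz; exact: sA.
move=> [y yx sAy]; have [z Az /andP[yz _]] := cA _ yx.
by have := sAy _ Az; rewrite /below /= ltNge yz.
Qed.

Lemma clubP C x : limit_ordinal x -> club C (below x) <->
  [/\ C `<=` below x, cofinal_in C x &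
      forall y, y < x -> limit_ordinal y -> cofinal_in C y -> C y].
Proof.
move=> xl; rewrite /club unbounded_belowP//; split.
  move=> [[sC cC] clC]; split=> // y yx yl /(cofinal_isLub _ yl); exact: clC.
move=> [sC cC clC]; split=> // y yx yl /(cofinal_isLub _ yl); exact: clC.
Qed.

(* Clubs of [L] are represented by the functions under which their points are
   closed. *)
Definition closed_pt h x := limit_ordinal x /\ forall y, y < x -> h y < x.

Lemma closed_pt_le h g x : (forall y, g y <= h y) -> closed_pt h x -> closed_pt g x.
Proof.
by move=> gh [xl hx]; split=> // y /hx; apply: le_lt_trans.
Qed.

Lemma closed_pt_const h y x : closed_pt h x -> h = cst y -> y < x.
Proof. by move=> [[[z zx] _] hx] hE; have := hx _ zx; rewrite hE. Qed.

End WellOrder.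

(** * Regular uncountable cardinals: bounds, clubs, pressing down *)

Section Regular.
Context {d : Order.disp_t} {L : orderType d}.
Context (L_wo : well_order (<=%O : rel L)).
Context (L_regular : regular_cardinal [set: L]).
Context (L_uncountable : ~ countable [set: L]).
Local Open Scope order_scope.
Implicit Types (A C D E P : set L) (h g f : L -> L) (x y z : L).

Lemma unbounded_card A x : unbounded_in A [set: L] -> ~ (A #<= below x).
Proof.
case: L_regular => _ _ cfL unA; have : cf [set: L] x by rewrite cfL.
by move=> /(_ A unA) /negP.
Qed.

Lemma full_card x : ~ ([set: L] #<= below x).
Proof.
case: L_regular => _ cL _; have : Defs.card [set: L] x by rewrite cL.
by move/negP.
Qed.

(** Regularity of lambda: the image has at most as many points as [below x], too few to be
    unbounded. *)
Lemma bound_below f x : exists b, forall y, y < x -> f y < b.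
Proof.
apply: contrapT => nb; apply: (@unbounded_card (f @` below x) x).
  split=> // -[b _ sb]; apply: nb; exists b => y yx; apply: sb.
  by exists y.
exact: card_image_le.
Qed.

Lemma point_exists : exists x : L, True.
Proof.
apply: contrapT => nx; apply: L_uncountable.
have -> : [set: L] = set0; first by apply/seteqP; split=> // x _; apply: nx; exists x.
exact: countable0.
Qed.

Lemma exists_gt x : exists y, x < y.
Proof.
case: (pselect (exists z, z < x)) => [[z zx]|x0].
  by have [b /(_ z zx)] := bound_below (cst x) x; exists b.
apply: contrapT => ny; case: L_regular => infL _ _; apply: infL.
have -> : [set: L] = [set x]; last exact: finite_set1.
apply/seteqP; split=> // y _; case: (ltgtP y x) => // yx.
  by case: x0; exists y.
by case: ny; exists y.
Qed.

Definition next x := projT1 (cid (exists_gt x)).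

Lemma lt_next x : x < next x.
Proof. exact: (projT2 (cid (exists_gt x))). Qed.

(** If all initial segments were finite, iterating [next] would give a cofinal sequence, and [L]
    would be a countable union of finite sets. *)
Lemma omega_point : exists x : L, infinite_set (below x).
Proof.
apply: contrapT => nx; apply: L_uncountable.
have {}nx x : finite_set (below x) by apply: contrapT => ix; apply: nx; exists x.
have [o _] := point_exists; pose e n := iter n next o.
have lt_e m n : (m < n)%N -> e m < e n.
  elim: n => // n IH; rewrite ltnS leq_eqVlt => /predU1P[->|/IH/lt_trans]; last apply.
    exact: lt_next.
  exact: lt_next.
have e_inj : injective e.
  move=> m n emn; case: (ltngtP m n) => // /lt_e; by rewrite emn ltxx.
have -> : [set: L] = \bigcup_n below (e n).
  apply/seteqP; split=> // x _; apply: contrapT => none.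
  case: (@infinite_nat); apply: card_le_finite (nx x).
  rewrite -(card_le_eql (inj_card_eq (f := e) _)); last by move=> ? ? _ _ /e_inj.
  apply: subset_card_le => _ [n _ <-]; rewrite /below /= ltNge le_eqVlt.
  apply/negP => /orP[/eqP xe|xe]; apply: none; last by exists n.
  by exists n.+1 => //; rewrite /below /= xe; exact: lt_next.
apply: bigcup_countable => // n _; exact: finite_set_countable.
Qed.

Lemma bound_seq (f : nat -> L) : exists b, forall n, f n < b.
Proof.
apply: contrapT => nb; have [w /infiniteP w_inf] := omega_point.
apply: (@unbounded_card (range f) w).
  split=> // -[b _ sb]; apply: nb; exists b => n; apply: sb.
  by exists n.
exact: card_le_trans (card_image_le _ _) w_inf.
Qed.

Lemma bound_image_le f : exists s : L -> L, forall x y, y <= x -> f y < s x.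
Proof.
suff /choice[s sP] : forall x, exists b, forall y, y <= x -> f y < b by exists s.
move=> x; have [b fb] := bound_below f (next x).
by exists b => y yx; apply/fb/(le_lt_trans yx)/lt_next.
Qed.

(** The point is the supremum of an omega-sequence in which each term dominates the values of [h] up
    to the previous term. *)
Lemma closed_pt_exists h a : exists2 x, closed_pt h x & a < x.
Proof.
have [s hs] := bound_image_le h.
pose u n := iter n (fun x => Order.max (next x) (s x)) a.
have lt_u n : u n < u n.+1 by rewrite /= lt_max lt_next.
have [|x [ubx minx]] := least_exists L_wo (P := [set x | forall n, u n < x]).
  exact: bound_seq.
have ex_u y : y < x -> exists n, y <= u n.
  move=> yx; apply: contrapT => none; move: yx; rewrite ltNge => /negP; apply.
  apply: minx => n /=; rewrite ltNge; apply/negP => yn; apply: none.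
  by exists n.
exists x; last exact: (ubx 0).
split; first split.
- by exists a; exact: (ubx 0).
- move=> y /ex_u[n yn]; exists (u n.+1).
  by rewrite (le_lt_trans yn (lt_u n)) ubx.
- move=> y /ex_u[n yn]; apply: lt_trans (hs _ _ yn) _.
  apply: le_lt_trans (ubx n.+1).
  by rewrite /= le_max lexx orbT.
Qed.

Lemma closed_pt_max h g x :
  closed_pt (fun y => Order.max (h y) (g y)) x -> closed_pt h x /\ closed_pt g x.
Proof.
by move=> hgx; split; apply: closed_pt_le hgx => y; rewrite le_max lexx ?orbT.
Qed.

Lemma club_closed_pt h : club [set x | closed_pt h x] [set: L].
Proof.
split; first split=> // -[b _ sb].
  by have [x /sb + bx] := closed_pt_exists h b; rewrite /below /= ltNge ltW.
move=> x _ xl /(cofinal_isLub _ xl) cx; split=> // y yx.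
by have [z [[_ hz] yz zx]] := cofinal_in_lt xl cx yx; rewrite (lt_trans (hz _ yz)).
Qed.

(** Let [h x] be a point of [C] at or above [x]; then [C] is cofinal in every point closed under
    [h]. *)
Lemma closed_pt_club C : club C [set: L] -> exists h, forall x, closed_pt h x -> C x.
Proof.
move=> [[_ unC] clC].
have /choice[h hP] : forall x, exists y, C y /\ x <= y.
  move=> x; apply: contrapT => none; apply: unC; exists x => // y Cy.
  rewrite /below /= ltNge; apply/negP => xy; apply: none; by exists y.
exists h => x [xl hx]; apply: clC => //; apply/(cofinal_isLub _ xl) => y /hx hy.
by exists (h y); [apply (hP y).1 | rewrite (hP y).2].
Qed.

(* Fodor's lemma. *)
Lemma press_down (S : set L) (f : L -> L) :
  (forall h, exists2 x, closed_pt h x & S x) -> (forall x, S x -> f x < x) ->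
  exists e, forall y, exists x, [/\ y < x, S x & f x = e].
Proof.
move=> statS fS; apply: contrapT => none.
(* A point [x] of [S] closed under [h] lies above the bound [h (f x)] of its own fibre, a
   contradiction. *)
have /choice[h hP] : forall e, exists y, forall x, S x -> f x = e -> x <= y.
  move=> e; apply: contrapT => ng; apply: none; exists e => g.
  apply: contrapT => nx; apply: ng; exists g => x Sx fx; rewrite leNgt.
  by apply/negP => gx; apply: nx; exists x.
have [x [_ hx] Sx] := statS h.
by have := hP _ _ Sx erefl; rewrite leNgt hx// fS.
Qed.

(** Transfinite recursion: each value is a point of [A] above all earlier values, which regularity
    keeps bounded. *)
Lemma unbounded_enum A : unbounded_in A [set: L] ->
  exists2 e : L -> L, injective e & forall x, A (e x).
Proof.
move=> [_ unA].
have /choice[up upP] : forall x, exists y, A y /\ x <= y.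
  move=> x; apply: contrapT => none; apply: unA; exists x => // y Ay.
  rewrite /below /= ltNge; apply/negP => xy; apply: none; by exists y.
have /choice[lub lubP] : forall p : L * (L -> L), exists b, forall y, y < p.1 -> p.2 y < b.
  by move=> [x f]; exact: bound_below.
(* The recursive call needs a proof of [y < x]; elsewhere [x] is a dummy value. *)
pose F x (r : forall y, y < x -> L) : L :=
  up (lub (x, fun y => if pselect (y < x) is left yx then r y yx else x)).
pose e := Fix (lt_wf L_wo) (fun=> L) F.
have eE x : e x = F x (fun y _ => e y).
  apply: (Init.Wf.Fix_eq _ _ F) => y f g fg; congr F.
  by apply: functional_extensionality_dep => z; apply: functional_extensionality_dep.
have e_mono y x : y < x -> e y < e x.
  move=> yx; rewrite [e x]eE /F.
  set p := (x, _); apply: lt_le_trans (upP (lub p)).2.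
  have := lubP p y yx; rewrite /p /=; case: pselect => //.
exists e => [x y exy|x]; last by rewrite eE; apply (upP _).1.
by case: (ltgtP x y) => // /e_mono; rewrite exy ltxx.
Qed.

Lemma unbounded_card_eq A : unbounded_in A [set: L] -> A #= [set: L].
Proof.
move=> /unbounded_enum[e e_inj eA]; rewrite card_eq_le card_leT /=.
rewrite -(card_le_eql (inj_card_eq (f := e) _)); last by move=> ? ? _ _ /e_inj.
by apply: subset_card_le => _ [x _ <-].
Qed.

End Regular.

(** * Walks along a C-sequence *)

Section Walks.
Context {d : Order.disp_t} {L : orderType d}.
Context (L_wo : well_order (<=%O : rel L)).
Local Open Scope order_scope.
Implicit Types (C : L -> set L) (a b x y z : L) (F s : seq L).

(** A C-sequence on all points: at a successor, [ladder_ge] forces the predecessor into [C x]. *)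
Record ladder C : Prop := Ladder {
  ladder_lt : forall x y, C x y -> y < x;
  ladder_ge : forall x y, y < x -> exists2 z, C x z & y <= z;
  ladder_closed : forall x y, y < x -> limit_ordinal y -> cofinal_in (C x) y -> C x y
}.

(* Only if [C z] accumulates at [x] can walks through [z] to targets just below
   [x] fail to be longer than the walk to [x]. *)
Definition culprit C x z := x < z /\ cofinal_in (C z) x.

(** The functions [h] stand for clubs. Restricting [F] to culprits loses nothing: any other [C z]
    with [z] above [x] is bounded below [x], and raising [y] avoids it. *)
Definition nontrivial_ladder C := forall h : L -> L, exists2 x, closed_pt h x &
  forall F, (forall z, z \in F -> culprit C x z) ->
  forall y, y < x -> exists a,
    [/\ y <= a, a < x, closed_pt h a & forall z, z \in F -> ~ C z a].

Context (C : L -> set L).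
Context (C_ladder : ladder C).

(** A walk that has arrived stays at its target, so [walk a b n <> a] means that more than [n] steps
    are needed. *)
Definition walk_step a b :=
  if a < b then
    xget b [set m | [/\ C b m, a <= m & forall z, C b z -> a <= z -> m <= z]]
  else b.

Definition walk a b n := iter n (walk_step a) b.

Lemma walk_stepP a b : a < b ->
  [/\ C b (walk_step a b), a <= walk_step a b, walk_step a b < b &
      forall z, C b z -> a <= z -> walk_step a b <= z].
Proof.
move=> ab; rewrite /walk_step ab.
have [m [[Cm am] minm]] := @least_exists _ _ L_wo [set z | C b z /\ a <= z]
  (let: ex_intro2 z Cz az := ladder_ge C_ladder ab in ex_intro _ z (conj Cz az)).
set S := [set m | _]; have [Cx ax minx] : S (xget b S).
  by apply: xgetPex; exists m; split=> // z Cz az; apply: minm.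
split=> //; exact: ladder_lt Cx.
Qed.

Lemma walk_step_id a : walk_step a a = a.
Proof. by rewrite /walk_step ltxx. Qed.

Lemma walk_step_ge a b : a <= b -> a <= walk_step a b.
Proof.
rewrite le_eqVlt => /predU1P[->|/walk_stepP[]//]; by rewrite walk_step_id.
Qed.

Lemma walk_ge a b n : a <= b -> a <= walk a b n.
Proof. by move=> ab; elim: n => //= n; exact: walk_step_ge. Qed.

Lemma walk_reach a b : a <= b -> exists n, walk a b n = a.
Proof.
elim/(well_founded_ind (lt_wf L_wo)): b => b IH.
rewrite le_eqVlt => /predU1P[->|ab]; first by exists 0.
have [_ am mb _] := walk_stepP ab.
by have [n wn] := IH _ mb am; exists n.+1; rewrite /walk iterSr.
Qed.

Lemma walk_stay a b m n : (m <= n)%N -> walk a b m = a -> walk a b n = a.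
Proof.
move=> /subnK <- wm; elim: (n - m)%N => //= k ->.
exact: walk_step_id.
Qed.

(** The gap of [C z] between [y] and [x] gives the targets [a] and [x] the same least point of [C z]
    at or above them. *)
Lemma walk_step_agree x z y a : x < z -> (forall u, C z u -> u < x -> u < y) ->
  y <= a -> a < x -> walk_step a z = walk_step x z.
Proof.
move=> xz Cy ya ax; have [Ca aa _ mina] := walk_stepP (lt_trans ax xz).
have [Cx xx _ minx] := walk_stepP xz; apply/le_anti.
rewrite mina ?(le_trans (ltW ax))//= minx// leNgt; apply/negP => /(Cy _ Ca).
by rewrite ltNge (le_trans ya aa).
Qed.

Lemma not_cofinal_gap A x : ~ cofinal_in A x ->
  exists2 y, y < x & forall u, A u -> u < x -> u < y.
Proof.
move=> ncA; apply: contrapT => none; apply: ncA => y yx.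
apply: contrapT => nz; apply: none; exists y => // u Au ux; rewrite ltNge.
by apply/negP => yu; apply: nz; exists u; rewrite ?yu.
Qed.

(** Induction on [n]. If the set used at a step accumulated at [x], it would contain [x] by closure
    and the step would land on [x]; so it has a gap below [x], and targets in the gap share the
    step. *)
Lemma walk_agree x b n : limit_ordinal x -> x <= b -> walk x b n <> x ->
  exists2 y, y < x & forall a, y <= a -> a < x -> walk a b n = walk x b n.
Proof.
move=> xl xb; have [x0 x0x] := xl.1; elim: n => [|n IH] far; first by exists x0.
have [|y yx yP] := IH; first by move=> wn; apply: far; rewrite /= wn walk_step_id.
have xz : x < walk x b n.
  rewrite lt_neqAle walk_ge// andbT; apply/eqP => xE.
  by apply: far; rewrite /= -xE walk_step_id.
have /not_cofinal_gap[y' y'x gap] : ~ cofinal_in (C (walk x b n)) x.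
  move=> /(ladder_closed C_ladder xz xl) Cx; apply: far => /=; apply/le_anti.
  have [_ xw _ minw] := walk_stepP xz.
  by rewrite xw minw.
exists (Order.max y y'); first by rewrite gt_max yx.
move=> a; rewrite ge_max => /andP[ya y'a] ax /=.
by rewrite yP// (walk_step_agree xz gap).
Qed.

Lemma far_below x b n : limit_ordinal x -> x <= b -> walk x b n <> x ->
  exists2 y, y < x & forall a, y <= a -> a < x -> walk a b n <> a.
Proof.
move=> xl xb /(walk_agree xl xb)[y yx yP]; exists y => // a ya ax.
rewrite yP// => wa; move: ax; rewrite -wa ltNge; apply/negP.
by rewrite negbK walk_ge.
Qed.

(** Targets just below [x] share the walk as far as [z], its [n]-th point. If [C z] accumulates at
    [x], the next step hits [a] only if [a] is in [C z]; if it has a gap there, the next step stays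
    at or above [x]. *)
Lemma far_step x b n : limit_ordinal x -> x <= b -> walk x b n <> x ->
  exists F, (forall z, z \in F -> culprit C x z) /\
  exists2 y, y < x & forall a, y <= a -> a < x ->
    (forall z, z \in F -> ~ C z a) -> walk a b n.+1 <> a.
Proof.
move=> xl xb far; have [y yx yP] := walk_agree xl xb far.
set z := walk x b n in far yP *.
have xz : x < z by rewrite lt_neqAle walk_ge// andbT eq_sym; apply/eqP.
case: (pselect (cofinal_in (C z) x)) => [cz|/not_cofinal_gap[y' y'x gap]].
  exists [:: z]; split=> [u /[!inE]/eqP->//|]; exists y => // a ya ax nC /=.
  rewrite yP// => wa; apply: (nC z); rewrite ?inE//.
  by have [] := walk_stepP (lt_trans ax xz); rewrite wa.
exists [::]; split=> //; exists (Order.max y y'); first by rewrite gt_max yx.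
move=> a; rewrite ge_max => /andP[ya y'a] ax _ /=.
rewrite yP// (walk_step_agree xz gap)// => wa.
by have [_] := walk_stepP xz; rewrite wa leNgt ax.
Qed.

Lemma far_step_seq x s n : limit_ordinal x ->
  (forall b, b \in s -> x < b /\ walk x b n <> x) ->
  exists F, (forall z, z \in F -> culprit C x z) /\
  exists2 y, y < x & forall a, y <= a -> a < x ->
    (forall z, z \in F -> ~ C z a) -> forall b, b \in s -> walk a b n.+1 <> a.
Proof.
move=> xl; have [x0 x0x] := xl.1.
elim: s => [|b s IH] far; first by exists [::]; split=> //; exists x0.
have [|F [FC [y yx yP]]] := IH; first by move=> u us; apply: far; rewrite inE us orbT.
have [|xb xfar] := far b; first by rewrite inE eqxx.
have [F' [F'C [y' y'x y'P]]] := far_step xl (ltW xb) xfar.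
exists (F ++ F'); split=> [z|].
  by rewrite mem_cat => /orP[/FC|/F'C].
exists (Order.max y y'); first by rewrite gt_max yx.
move=> a; rewrite ge_max => /andP[ya y'a] ax FF' u.
rewrite inE => /predU1P[->|us].
  by apply: y'P => // z zF; apply: FF'; rewrite mem_cat zF orbT.
by apply: yP => // z zF; apply: FF'; rewrite mem_cat zF.
Qed.

Lemma far_below_seq x s n : limit_ordinal x ->
  (forall b, b \in s -> x < b /\ walk x b n <> x) ->
  exists2 y, y < x & forall a, y <= a -> a < x ->
    forall b, b \in s -> walk a b n <> a.
Proof.
move=> xl; have [x0 x0x] := xl.1.
elim: s => [|b s IH] far; first by exists x0.
have [|y yx yP] := IH; first by move=> u us; apply: far; rewrite inE us orbT.
have [|xb xfar] := far b; first by rewrite inE eqxx.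
have [y' y'x y'P] := far_below xl (ltW xb) xfar.
exists (Order.max y y'); first by rewrite gt_max yx.
move=> a; rewrite ge_max => /andP[ya y'a] ax u.
by rewrite inE => /predU1P[->|us]; [apply: y'P | apply: yP].
Qed.

End Walks.

(** * Long walks between members of a disjoint family of finite sets *)

Section Unbounded.
Context {d : Order.disp_t} {L : orderType d}.
Context (L_wo : well_order (<=%O : rel L)).
Context (L_regular : regular_cardinal [set: L]).
Context (L_uncountable : ~ countable [set: L]).
Local Open Scope order_scope.
Implicit Types (a b x y z : L).

Context (C : L -> set L) (w : L -> seq L).
Context (C_ladder : ladder C).
Context (C_nontrivial : nontrivial_ladder C).
Context (w_disjoint : forall x y, x <> y -> forall i, i \in w x -> i \notin w y).

(** By disjointness each point lies in at most one [w a], so the indices of the sets that meet the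
    points up to [x] are bounded. *)
Lemma family_above x : exists2 a, x < a & forall b, b \in w a -> x < b.
Proof.
have [q xq] := exists_gt L_regular x.
have /choice[f fP] : forall y, exists a, forall u, y \in w u -> u = a.
  move=> y; case: (pselect (exists u, y \in w u)) => [[u yu]|none].
    exists u => v yv; apply: contrapT => /w_disjoint/(_ _ yv).
    by rewrite yu.
  by exists x => u yu; case: none; exists u.
have [c fc] := bound_below L_regular f q.
pose a := Order.max c q; exists a; first by rewrite lt_max xq orbT.
move=> b ba; rewrite ltNge; apply/negP => bx.
have := fc _ (le_lt_trans bx xq); rewrite -(fP _ _ ba) ltNge.
by rewrite le_max lexx.
Qed.

Definition far_family n x a :=
  x < a /\ forall b, b \in w a -> x < b /\ walk C x b n <> x.

(** Farness from [x] spreads to a tail of targets below [x], starting at some [e] that depends on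
    [x]; pressing down makes one [e] serve unboundedly many [x]. *)
Lemma far_family_below n :
  (forall h, exists2 x, closed_pt h x & exists a, far_family n x a) ->
  exists e, forall y, exists x a, [/\ y < x, x < a, e < x &
    forall b, b \in w a -> x < b /\
      forall t, e <= t -> t < x -> walk C t b n <> t].
Proof.
move=> far.
pose S x := exists e a, [/\ e < x, x < a &
    forall b, b \in w a -> x < b /\
      forall t, e <= t -> t < x -> walk C t b n <> t].
have /choice[f fP] : forall x, exists e, S x -> e < x /\ exists2 a, x < a &
    forall b, b \in w a -> x < b /\
      forall t, e <= t -> t < x -> walk C t b n <> t.
  move=> x; case: (pselect (S x)) => [[e [a [ex xa eP]]]|nS]; last by exists x.
  by exists e => _; split=> //; exists a.
have [h|x Sx|e eP] := press_down (S := S) (f := f).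
- have [x hx [a [xa aP]]] := far h; exists x => //.
  have [e ex eP] := far_below_seq L_wo C_ladder hx.1 aP.
  exists e, a; split=> // b ba; split; first exact: (aP _ ba).1.
  by move=> t et tx; apply: eP.
- by have [] := fP _ Sx.
exists e => y; have [x [yx Sx fx]] := eP y.
have [fxx [a xa aP]] := fP _ Sx; exists x, a; split=> //; first by rewrite -fx.
by rewrite -fx.
Qed.

(** Induction on [n]; each use of nontriviality lengthens the walks by one step. *)
Lemma far_family_exists n h : exists2 x, closed_pt h x & exists a, far_family n x a.
Proof.
elim: n h => [|n IH] h.
  have [x hx _] := closed_pt_exists L_wo L_regular L_uncountable h
    (projT1 (cid (point_exists L_uncountable))).
  have [a xa aP] := family_above x; exists x => //; exists a; split=> // b /aP xb.
  by split=> //; apply/eqP; rewrite gt_eqF.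
have [e eP] := far_family_below IH.
have [x hx xP] := C_nontrivial (fun y => Order.max (h y) e).
have {}hx' : closed_pt h x by apply: closed_pt_le hx => y; rewrite le_max lexx.
have ex : e < x.
  by have [[[z zx] _] /(_ _ zx)] := hx; rewrite gt_max => /andP[].
(* As [e < x < g], the family [w a] is far from [x] itself. A target [t < x] closed under [h] and
   outside the finitely many culprit sets then needs one step more. *)
have [g [a [xg ga _ gP]]] := eP x.
have [|F [FC [y yx yP]]] := far_step_seq (n := n) L_wo C_ladder hx.1 (s := w a).
  move=> b /gP[gb bfar]; split; first exact: lt_trans gb.
  by apply: bfar => //; exact: ltW.
have [t [yt tx ht tF]] := xP _ FC _ yx.
exists t; first by apply: closed_pt_le ht => u; rewrite le_max lexx.
exists a; split=> [|b ba]; first exact: lt_trans tx (lt_trans xg ga).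
split; last exact: yP.
exact: lt_trans tx (lt_trans xg (gP _ ba).1).
Qed.

Lemma far_homogeneous n : exists2 X, X #= [set: L] &
  forall x y, X x -> X y -> x < y -> forall i j, i \in w x -> j \in w y ->
    i < j /\ walk C i j n <> i.
Proof.
have [e eP] := far_family_below (far_family_exists n).
have /choice[D DP] := eP.
have /choice[a aP] := DP.
have /choice[m mP] : forall y, exists m, a y < m /\ forall i, i \in w (a y) -> i < m.
  move=> y; elim: (w (a y)) => [|i s [m [am IH]]].
    by have [m am] := exists_gt L_regular (a y); exists m.
  have [m' im'] := exists_gt L_regular i; exists (Order.max m m').
  split=> [|j]; first by rewrite lt_max am.
  by rewrite inE => /predU1P[->|/IH jm]; rewrite lt_max ?im' ?jm ?orbT.
have lt_a y : y < a y by have [+ + _ _] := aP y; exact: lt_trans.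
(* Closure under [m] separates the families: for [y < z] in [Z], all of [w (a y)] lies between [e]
   and [D z], among the targets from which [w (a z)] is far. *)
pose Z := [set y | closed_pt m y /\ e < y].
have a_mono y z : Z z -> y < z -> a y < a z.
  move=> [[_ mz] _] /mz yz; exact: lt_trans (mP y).1 (lt_trans yz (lt_a z)).
exists (a @` Z).
  apply: unbounded_card_eq => //; split=> // -[b _ sb].
  have [y [my]] := closed_pt_exists L_wo L_regular L_uncountable m (Order.max b e).
  move=> my'; rewrite gt_max => /andP[bY eY].
  have : below b (a y) by apply: sb; exists y.
  by rewrite /below /= ltNge ltW// (lt_trans bY).
move=> _ _ [y Zy <-] [z Zz <-] ayz i j iy jz.
have yz : y < z.
  by rewrite ltNge le_eqVlt; apply/negP => /predU1P[zy|/(a_mono _ _ Zy)];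
    [move: ayz; rewrite zy ltxx | rewrite ltNge ltW].
have iz : i < z by apply: lt_trans (Zz.1.2 _ yz); exact: (mP y).2.
have [zD _ _ /(_ j jz)[Dj jfar]] := aP z.
split; first exact: lt_trans iz (lt_trans zD Dj).
apply: jfar; last exact: lt_trans zD.
have [yD _ _ /(_ i iy)[Di _]] := aP y.
exact/ltW/(lt_trans Zy.2)/(lt_trans yD).
Qed.

End Unbounded.

(** * Nontrivial C-sequences from the hypotheses *)

Section Ladders.
Context {d : Order.disp_t} {L : orderType d}.
Context (L_wo : well_order (<=%O : rel L)).
Context (L_regular : regular_cardinal [set: L]).
Context (L_uncountable : ~ countable [set: L]).
Local Open Scope order_scope.
Implicit Types (C : L -> set L) (A D : set L) (x y z : L) (F : seq L).

(** A non-limit point gets the set of its predecessor, if any, which accumulates at no limit. So a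
    culprit at a limit is itself a limit, and its club is controlled by [R]. *)
Lemma ladder_exists (R : L -> set L -> Prop) :
  (forall x, limit_ordinal x -> exists D, club D (below x) /\ R x D) ->
  exists C, [/\ ladder C, forall x, limit_ordinal x -> R x (C x) &
    forall x z, limit_ordinal x -> culprit C x z -> limit_ordinal z].
Proof.
move=> RD; have /choice[C CP] : forall x, exists D,
    (limit_ordinal x -> club D (below x) /\ R x D) /\
    (~ limit_ordinal x -> D = [set y | y < x /\ forall z, z < x -> z <= y]).
  move=> x; case: (pselect (limit_ordinal x)) => [/[dup] xl /RD[D DP]|nl].
    by exists D; split.
  by eexists; split=> // _; reflexivity.
have maxC x y : limit_ordinal y -> y < x -> cofinal_in (C x) y -> limit_ordinal x.
  move=> yl yx cC; apply: contrapT => /(CP x).2 CE; have [u uy] := yl.1.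
  have [v + /andP[_ vy]] := cC _ uy; rewrite CE => -[_ /(_ _ yx)].
  by rewrite leNgt vy.
have limC x : limit_ordinal x -> club (C x) (below x).
  by move=> /(CP x).1[].
exists C; split=> [|x /(CP x).1[]//|x z xl [xz cC]]; last exact: maxC cC.
split.
- move=> x y; case: (pselect (limit_ordinal x)) => xl.
    by have [+ _ _] := (clubP _ xl).1 (limC _ xl); apply.
  by rewrite (CP x).2// => -[].
- move=> x y yx; case: (pselect (limit_ordinal x)) => xl.
    have [_ + _] := (clubP _ xl).1 (limC _ xl) => /(_ _ yx)[z Cz /andP[yz _]].
    by exists z.
  rewrite (CP x).2//; apply: contrapT => none; apply: xl; split; first by exists y.
  move=> z zx; apply: contrapT => nz; apply: none.
  have zmax u : u < x -> u <= z.
    by move=> ux; rewrite leNgt; apply/negP => zu; apply: nz; exists u; rewrite zu.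
  by exists z; [split | apply: zmax].
- move=> x y yx yl cC; have xl := maxC _ _ yl yx cC.
  by have [_ _] := (clubP _ xl).1 (limC _ xl); apply.
Qed.

Lemma tail_club x z : limit_ordinal z -> x < z ->
  club [set y | x <= y < z] (below z).
Proof.
move=> zl xz; apply/(clubP _ zl); split=> [y /andP[]//|y yz|y yz yl cy].
  exists (Order.max x y); first by rewrite /= le_max lexx gt_max xz.
  by rewrite le_max lexx orbT gt_max xz.
have [u uy] := yl.1; have [v /andP[xv _] /andP[_ vy]] := cy _ uy.
by rewrite /= yz (le_trans xv) ?ltW.
Qed.

(** * Singular and inaccessible points, and clubs of small order type *)

Definition cofinal_map (f : L -> L) k x :=
  (forall i, i < k -> f i < x) /\ forall y, y < x -> exists2 i, i < k & y <= f i.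

Definition singular x := exists k f, k < x /\ cofinal_map f k x.

(** Regularity of an ordinal for partial maps: only values inside [k] are bounded. The ordinal 1
    also qualifies. *)
Definition regular_point k := forall i (f : L -> L), i < k ->
  exists2 b, b < k & forall j, j < i -> f j < k -> f j < b.

Definition short D x k := exists2 i, i < k &
  exists f : L -> L, forall y, D y -> y < x -> exists2 j, j < i & y = f j.

Definition small D x := exists k, [/\ k < x, regular_point k & short D x k].

(** With [k] the cofinality of [x], let [D] be the range of a continuous cofinal function on [k],
    cut off above [k]. Below an accumulation point [y] only indices under some [i < k] contribute,
    and the cut gives [k < y]. *)
Lemma singular_club x : limit_ordinal x -> singular x ->
  exists D, club D (below x) /\
    forall y, y < x -> limit_ordinal y -> cofinal_in D y -> small D y.
Proof.
move=> xl [k0 [a0 [k0x a0P]]].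
have [k [[a [a_lt a_cof]] mink]] := @least_exists _ _ L_wo
  [set k | exists f, cofinal_map f k x] (ex_intro _ k0 (ex_intro _ a0 a0P)).
have kx : k < x by apply: le_lt_trans (mink _ _) k0x; exists a0.
(* [l i] is the least strict upper bound of [a] on [below i], which makes [l] nondecreasing and
   continuous. *)
have /choice[l lP] : forall i, exists b, (forall j, j < i -> a j < b) /\
    forall b', (forall j, j < i -> a j < b') -> b <= b'.
  move=> i; have [|b] := @least_exists _ _ L_wo [set b | forall j, j < i -> a j < b].
    exact: bound_below.
  by exists b.
have l_mono i j : i <= j -> l i <= l j.
  by move=> ij; apply: (lP i).2 => u ui; apply: (lP j).1; apply: lt_le_trans ij.
have l_ltE i j : l i < l j -> i < j.
  by move=> lij; rewrite ltNge; apply/negP => /l_mono; rewrite leNgt lij.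
have l_lt i : i < k -> l i < x.
  move=> ik; apply: contrapT => /negP; rewrite -leNgt => xli.
  have : k <= i; last by rewrite leNgt ik.
  apply: mink; exists a; split=> [j ji|y yx].
    by apply: a_lt; apply: lt_trans ik.
  apply: contrapT => none; move: xli; rewrite leNgt => /negP; apply.
  apply: le_lt_trans yx; apply: (lP i).2 => j ji; rewrite ltNge.
  by apply/negP => yj; apply: none; exists j.
have l_cof y : y < x -> exists2 i, i < k & y < l i.
  move=> yx; have [i ik yi] := a_cof _ yx.
  have [u iu ux] := limit_lt xl (a_lt _ ik).
  have [j jk uj] := a_cof _ ux.
  case: (ltgtP i j) => ij.
  - by exists j => //; apply: le_lt_trans yi _; apply: (lP j).1.
  - exists i => //; apply: lt_trans ((lP i).1 _ ij).
    exact: le_lt_trans yi (lt_le_trans iu uj).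
  - by move: uj; rewrite -ij leNgt iu.
(* A map from some [i < k] cofinal in [k], followed by [l], would contradict the minimality of
   [k]. *)
have k_reg : regular_point k.
  move=> i f ik; apply: contrapT => none.
  have : k <= i; last by rewrite leNgt ik.
  have [x0 x0x] := xl.1.
  apply: mink; exists (fun j => if f j < k then l (f j) else x0).
  split=> [j _|y /l_cof[b bk yb]]; first by case: ifP => // /l_lt.
  apply: contrapT => ny; apply: none; exists b => // j ji fjk.
  rewrite ltNge; apply/negP => /l_mono bfj; apply: ny; exists j => //.
  by rewrite fjk (le_trans (ltW yb)).
pose D := [set y | exists2 i, i < k & y = l i /\ k < y].
exists D; split.
  apply/(clubP _ xl); split.
  - by move=> _ [i ik [-> _]]; exact: l_lt.
  - move=> y yx; have [|i ik] := l_cof (Order.max y k); first by rewrite gt_max yx.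
    rewrite gt_max => /andP[yl kl]; exists (l i); first by exists i.
    by rewrite ltW//= l_lt.
  - move=> y yx yl cy; have [i0 i0k yi0] := l_cof _ yx.
    (* For [j < i], minimality gives [l j < y]; a larger value [l j'] still below [y] then exceeds
       [a j]. Hence [l i <= y]. *)
    have [i [yi mini]] := @least_exists _ _ L_wo [set i | y <= l i]
      (ex_intro _ i0 (ltW yi0)).
    exists i; first exact: le_lt_trans (mini _ (ltW yi0)) i0k.
    split.
      apply/le_anti; rewrite yi/=; apply: (lP i).2 => j ji.
      have ljy : l j < y.
        by rewrite ltNge; apply/negP => /mini; rewrite leNgt ji.
      have [_ [[j' j'k [-> _]] /l_ltE jj' jy]] := cofinal_in_lt yl cy ljy.
      by apply: lt_trans jy; apply: (lP j').1.
    have [u uy] := yl.1; have [v [_ _ [_ kv]] /andP[_ vy]] := cy _ uy.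
    exact: lt_trans vy.
move=> y yx yl cy; exists k; split=> //.
  have [u uy] := yl.1; have [v [_ _ [_ kv]] /andP[_ vy]] := cy _ uy.
  exact: lt_trans vy.
have [i ik yi] := l_cof _ yx; exists i => //; exists l => z [j jk [-> _]] jy.
by exists j => //; apply: l_ltE; apply: lt_trans yi.
Qed.

Lemma card_singular A x y : limit_ordinal x -> cofinal_in A x -> y < x ->
  A #<= below y -> singular x.
Proof.
move=> xl cA yx /(card_le_cover x)[g gP]; have [x0 x0x] := xl.1.
exists y, (fun i => if g i < x then g i else x0); split=> //.
split=> [i _|z zx]; first by case: ifP.
have [u Au /andP[zu ux]] := cA _ zx; have [i iy giu] := gP _ Au.
by exists i => //; rewrite giu ux.
Qed.

Lemma cofinal_below x : cofinal_in (below x) x.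
Proof. by move=> y yx; exists y; rewrite ?lexx. Qed.

Lemma is_cardinalP x :
  is_cardinal (below x) <-> forall y, y < x -> ~ (below x #<= below y).
Proof.
split=> [cx y yx|nx]; first by have /negP : Defs.card (below x) y by rewrite cx.
apply/seteqP; split=> y; last by move=> /nx /negP.
move=> /negP nxy; rewrite /below /= ltNge; apply/negP => xy; apply: nxy.
by apply: subset_card_le => z zx; exact: lt_le_trans xy.
Qed.

Lemma limit_infinite x : limit_ordinal x -> infinite_set (below x).
Proof.
move=> xl /finite_seqP[s sE]; have [x0 x0x] := xl.1.
have [b bx sb] : exists2 b, b < x & forall z, z \in s -> z <= b.
  have : forall z, z \in s -> z < x by move=> z zs; suff : below x z by []; rewrite sE.
  elim: s {sE} => [|y s IH] sx; first by exists x0.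
  have [|b bx sb] := IH; first by move=> z zs; apply: sx; rewrite inE zs orbT.
  exists (Order.max y b); first by rewrite gt_max bx sx// inE eqxx.
  by move=> z; rewrite inE le_max => /predU1P[->|/sb ->]; rewrite ?lexx ?orbT.
have [z bz zx] := limit_lt xl bx.
have : z \in s by have := zx : below x z; rewrite sE.
by move=> /sb; rewrite leNgt bz.
Qed.

Lemma nonsingular_regular x : limit_ordinal x -> ~ singular x ->
  regular_cardinal (below x).
Proof.
move=> xl nx; have cx : is_cardinal (below x).
  apply/is_cardinalP => y yx /(card_singular xl (@cofinal_below x) yx).
  exact: nx.
split=> //; first exact: limit_infinite.
apply/seteqP; split=> y.
  move=> /(_ (below x)); rewrite cx; apply.
  by apply/(unbounded_belowP _ xl); split=> //; exact: cofinal_below.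
move=> yx A /(unbounded_belowP _ xl)[_ cA]; apply/negP.
by move=> /(card_singular xl cA yx).
Qed.

Lemma inaccessible_not_small D x : limit_ordinal x -> S_in L x -> cofinal_in D x ->
  ~ small D x.
Proof.
move=> xl [_ [_ _ cfx] _] cD [k [kx _ [i ik [f fP]]]].
have : cf (below x) i by rewrite cfx; exact: lt_trans kx.
move=> /(_ (below x `&` D)) cA; have /negP : Defs.card (below x `&` D) i.
  apply: cA; apply/(unbounded_belowP _ xl); split=> [y []//|y yx].
  have [z Dz /andP[yz zx]] := cD _ yx.
  by exists z => //; rewrite yz.
apply; apply: (cover_card_le (g := f)) => y [yx Dy].
by have [j ji ->] := fP _ Dy yx; exists j.
Qed.

(** For singular [x], accumulation points of the club from [singular_club] are small. For countable
    [x] any tail works. Otherwise [x] is regular uncountable but not a limit cardinal, and the tail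
    from a bound [mu] of the cardinals below [x] works. *)
Lemma noninaccessible_club x : limit_ordinal x -> ~ S_in L x ->
  exists D, club D (below x) /\
    forall y, y < x -> limit_ordinal y -> S_in L y -> ~ cofinal_in D y.
Proof.
move=> xl nx; case: (pselect (singular x)) => [/(singular_club xl)[D [clD smD]]|].
  exists D; split=> // y yx yl Sy cy.
  exact: (inaccessible_not_small yl Sy cy (smD _ yx yl cy)).
move=> /(nonsingular_regular xl) regx; have [x0 x0x] := xl.1.
case: (pselect (countable (below x))) => [cx|ncx].
  exists [set y | x0 <= y < x]; split; first exact: tail_club.
  move=> y yx _ [ncy _ _] _; apply: ncy; apply: sub_countable cx.
  by apply: subset_card_le => z zy; exact: lt_trans yx.
have [mu [mux mumax]] : exists mu, mu < x /\
    forall nu, nu < x -> is_cardinal (below nu) -> nu <= mu.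
  apply: contrapT => none; apply: nx; split=> //; split; first by case: regx.
  move=> mu mux _; apply: contrapT => nnu; apply: none; exists mu; split=> // nu nux cnu.
  by rewrite leNgt; apply/negP => munu; apply: nnu; exists nu.
exists [set y | mu <= y < x]; split; first exact: tail_club.
move=> y yx yl [_ [_ cy _] _] cofy; have := mumax _ yx cy.
have [u uy] := yl.1; have [v /andP[muv _] /andP[_ vy]] := cofy _ uy.
by rewrite leNgt (le_lt_trans muv).
Qed.

(** If lambda is not inaccessible, its cardinals are bounded, and points beyond the bound are not
    regular. Otherwise some club misses the inaccessibles, and its uncountable points that are
    limits of cardinals cannot be regular. *)
Lemma nonMahlo_singular : ~ Mahlo L ->
  exists g, forall x, closed_pt g x -> singular x.
Proof.
move=> nM; case: (pselect (inaccessible [set: L])) => [inL|ninL]; last first.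
  have [mu mumax] : exists mu : L, forall nu, is_cardinal (below nu) -> nu <= mu.
    apply: contrapT => none; apply: ninL; split=> //; split.
      by case: L_regular.
    move=> mu _ _; apply: contrapT => nnu; apply: none; exists mu => nu cnu.
    by rewrite leNgt; apply/negP => munu; apply: nnu; exists nu.
  exists (cst mu) => x hx; apply: contrapT => /(nonsingular_regular hx.1)[_ cx _].
  by have := mumax _ cx; rewrite leNgt (closed_pt_const hx).
have /choice[nc ncP] : forall x, exists nu, is_cardinal (below nu) /\ x < nu.
  move=> x; have [nu' [xnu' minnu']] := @least_exists _ _ L_wo
    [set y | below x #<= below y] (ex_intro _ x (card_lexx (below x))).
  have cnu' : is_cardinal (below nu').
    apply/is_cardinalP => y ynu' nu'y.
    by have := minnu' _ (card_le_trans xnu' nu'y); rewrite leNgt ynu'.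
  have [_ _ [_ /(_ nu' I cnu')[nu [_ cnu nu'nu]]]] := inL.
  exists nu; split=> //; rewrite ltNge; apply/negP => nux.
  apply: ((is_cardinalP nu).1 cnu _ nu'nu); apply: card_le_trans xnu'.
  by apply: subset_card_le => y ynu; exact: lt_le_trans nux.
have [E [clE nE]] : exists E, club E [set: L] /\ forall x, S_in L x -> ~ E x.
  apply: contrapT => none; apply: nM; split=> // E clE; apply: contrapT => nx.
  by apply: none; exists E; split=> // x Sx Ex; apply: nx; exists x.
have [e eP] := closed_pt_club clE.
have [w /infiniteP w_inf] := omega_point L_regular L_uncountable.
pose g x := Order.max (Order.max (e x) (nc x)) (nc w); exists g => x.
move=> /closed_pt_max[/closed_pt_max[ex ncx] wx].
apply: contrapT => /(nonsingular_regular ex.1) regx; apply: nE (eP _ ex).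
have {}wx : nc w < x by exact: closed_pt_const wx _.
split=> //.
- move=> cx; have [cnc wnc] := ncP w.
  apply: ((is_cardinalP (nc w)).1 cnc _ wnc); apply: card_le_trans w_inf.
  by apply: card_le_trans cx; apply: subset_card_le => y ync; exact: lt_trans wx.
- split; first by case: regx.
  move=> mu mux _; exists (nc mu); split; [exact: ncx.2 | exact: (ncP _).1|].
  exact: (ncP _).2.
Qed.

(** The largest of the finitely many witnesses [k] serves for all. *)
Lemma small_seq C x F : limit_ordinal x -> (forall z, z \in F -> small (C z) x) ->
  exists k, [/\ k < x, regular_point k, below k !=set0 &
    forall z, z \in F -> short (C z) x k].
Proof.
move=> xl; elim: F => [|z F IH] smF.
  (* For the empty list [k] is 1, the successor of the least point [o]. *)
  have [x0 x0x] := xl.1; have [o [_ mino]] := least_exists L_wo (ex_intro setT x0 I).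
  have [k [ok mink]] := least_exists L_wo
    (exists_gt L_regular o : [set y | o < y] !=set0).
  have kx : k < x.
    have [y oy yx] := limit_lt xl (le_lt_trans (mino _ I) x0x).
    exact: le_lt_trans (mink _ oy) yx.
  exists k; split=> //; last by exists o.
  move=> i f ik; exists o => // j ji; have : j < o; last by rewrite ltNge mino.
  apply: lt_le_trans ji _; rewrite leNgt; apply/negP => /mink.
  by rewrite leNgt ik.
have [|k [kx kreg k0 kP]] := IH; first by move=> u uF; apply: smF; rewrite inE uF orbT.
have [|k' [k'x k'reg [i ik' fP]]] := smF z; first by rewrite inE eqxx.
case: (leP k k') => kk'.
  exists k'; split=> //; first by case: k0 => u uk; exists u; exact: lt_le_trans kk'.
  move=> u; rewrite inE => /predU1P[->|/kP[j jk jP]]; first by exists i.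
  by exists j => //; exact: lt_le_trans kk'.
exists k; split=> // u; rewrite inE => /predU1P[->|/kP//].
by exists i => //; exact: lt_trans kk'.
Qed.

(* Each [C z] pulls back along [e] to a set bounded in [k], by regularity; so no
   cardinal arithmetic is needed. *)
Lemma short_seq_avoid C F x k (e : L -> L) : regular_point k -> below k !=set0 ->
  (forall z, z \in F -> short (C z) x k) -> injective e ->
  (forall i, i < k -> e i < x) ->
  exists2 i, i < k & forall z, z \in F -> ~ C z (e i).
Proof.
move=> kreg [k0 k0k] shF e_inj ex.
suff [b bk bP] : exists2 b, b < k &
    forall i, i < k -> forall z, z \in F -> C z (e i) -> i < b.
  by exists b => // z zF /(bP _ bk _ zF); rewrite ltxx.
elim: F shF => [|z F IH] shF; first by exists k0.
have [|b bk bP] := IH; first by move=> u uF; apply: shF; rewrite inE uF orbT.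
have [|i ik [f fP]] := shF z; first by rewrite inE eqxx.
(* [r] inverts [e], with default [k0]; regularity of [k] bounds the indices [r (f v)], hence all [j]
   with [e j] in [C z]. *)
have /choice[r rP] : forall y, exists j, forall j', e j' = y -> j = j'.
  move=> y; case: (pselect (exists j, e j = y)) => [[j <-]|nj].
    by exists j => j' /e_inj.
  by exists k0 => j' ej'; case: nj; exists j'.
have [b' b'k b'P] := kreg i (r \o f) ik.
exists (Order.max b b'); first by rewrite gt_max bk.
move=> j jk u; rewrite inE lt_max => /predU1P[->|uF] Cu; last by rewrite (bP _ jk _ uF).
have [v vi ejE] := fP _ Cu (ex _ jk); have rfv : r (f v) = j by exact: rP.
by have := b'P v vi; rewrite /= rfv => ->; rewrite ?orbT.
Qed.

(* A culprit at [x] has fewer than [k] points below [x] for some regular [k < x],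
   while for club many [x] the points closed under [h] in any tail below [x] are at
   least [k] many, for all [k < x]. *)
Lemma nonMahlo_ladder : ~ Mahlo L ->
  exists2 C : L -> set L, ladder C & nontrivial_ladder C.
Proof.
move=> /nonMahlo_singular[g gP].
pose R z D := forall y, y < z -> closed_pt g y -> cofinal_in D y -> small D y.
have [z zl|C [ladC RC limC]] := @ladder_exists R.
  case: (pselect (closed_pt g z)) => [/gP/(singular_club zl)[D [clD smD]]|ng].
    by exists D; split=> // y yz [yl _]; exact: smD.
  (* A tail from a witness [x] of non-closure accumulates at no closed [y < z]: such a [y] would be
     above [x], yet [g x >= z > y]. *)
  have [x xz zgx] : exists2 x, x < z & z <= g x.
    apply: contrapT => none; apply: ng; split=> // x xz; rewrite ltNge.
    by apply/negP => zgx; apply: none; exists x.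
  exists [set y | x <= y < z]; split; first exact: tail_club.
  move=> y yz [yl gy] cy; have [u uy] := yl.1.
  have [v /andP[xv _] /andP[_ vy]] := cy _ uy.
  by have := lt_trans (gy _ (le_lt_trans xv vy)) yz; rewrite ltNge zgx.
exists C => // h.
(* [q x] bounds the first [x] values of an injective enumeration of closed points beyond [x];
   closure under [q] thus leaves many closed points in every tail. *)
have /choice[q qP] : forall x, exists b, exists2 e : L -> L, injective e &
    (forall i, closed_pt h (e i) /\ x <= e i) /\ forall i, i < x -> e i < b.
  move=> x; have [|e e_inj eP] :=
      @unbounded_enum _ _ L_wo L_regular [set y | closed_pt h y /\ x <= y].
    split=> // -[b _ sb].
    have [y hy] := closed_pt_exists L_wo L_regular L_uncountable h (Order.max x b).
    rewrite gt_max => /andP[xy bY]; have : below b y by apply: sb; rewrite /= ltW.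
    by rewrite /below /= ltNge ltW.
  by have [b eb] := bound_below L_regular e x; exists b, e.
have [o _] := point_exists L_uncountable.
have [x + _] := closed_pt_exists L_wo L_regular L_uncountable
  (fun y => Order.max (Order.max (h y) (g y)) (q y)) o.
move=> /closed_pt_max[/closed_pt_max[hx gx] qx]; exists x => // F FC y yx.
have [z zF|k [kx kreg k0 kP]] := @small_seq C x F hx.1.
  have [xz cz] := FC _ zF; apply: RC => //; exact: limC hx.1 (FC _ zF).
pose m := Order.max k y; have mx : m < x by rewrite gt_max kx.
have [e e_inj [eh eq]] := qP m.
have [i ik|i ik iF] := @short_seq_avoid C F x k e kreg k0 kP e_inj.
  by apply: lt_trans (eq _ _) (qx.2 _ mx); rewrite lt_max ik.
exists (e i); split=> //; first 2 last.
- exact: (eh i).1.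
- by apply: le_trans (eh i).2; rewrite le_max lexx orbT.
- by apply: lt_trans (eq _ _) (qx.2 _ mx); rewrite lt_max ik.
Qed.

(** * C-sequences from the guessing principles *)

Lemma seq_enum F : exists z f, omega L z /\
  forall y, (y \in F) <-> exists2 i, i < z & f i = y.
Proof.
have [x0 _] := point_exists L_uncountable.
elim: F => [|y F [z [f [zfin fP]]]].
  have [o [_ mino]] := least_exists L_wo (ex_intro setT x0 I).
  have oN i : ~ (i < o) by rewrite ltNge mino.
  exists o, id; split; first by rewrite /omega /= (_ : below o = set0)//;
    apply/seteqP; split=> // i /oN.
  by move=> u; split=> // -[i /oN].
have [z' [zz' minz']] := least_exists L_wo
  (exists_gt L_regular z : [set y | z < y] !=set0).
have z'E i : i < z' -> i = z \/ i < z.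
  move=> iz'; case: (ltgtP i z) => [|zi|]; [by right | | by left].
  by have := minz' _ zi; rewrite leNgt iz'.
exists z', (fun i => if i == z then y else f i); split.
  apply: (@sub_finite_set _ _ (below z `|` [set z])); last first.
    by rewrite finite_setU; split=> //; exact: finite_set1.
  by move=> i /z'E[->|]; [right | left].
move=> u; rewrite inE; split=> [/predU1P[->|/fP[i iz <-]]|[i /z'E[->|iz]]].
- by exists z; rewrite ?eqxx.
- by exists i; [exact: lt_trans zz' | rewrite lt_eqF].
- by rewrite eqxx => ->; rewrite eqxx.
- by rewrite lt_eqF// => fu; apply/orP; right; apply/fP; exists i.
Qed.

Lemma unbounded_avoid (S : set L) (C : L -> set L) A x :
  ~ (exists zeta : L, exists alpha : L -> L,
      [/\ omega L zeta, forall eps, eps < zeta -> S (alpha eps) &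
          bounded_in ((A `&` below x) `\` \bigcup_(eps in below zeta) C (alpha eps))
                     (below x)]) ->
  forall F, (forall z, z \in F -> S z) -> forall y, y < x -> exists a,
    [/\ y <= a, a < x, A a & forall z, z \in F -> ~ C z a].
Proof.
move=> nb F FS y yx; apply: contrapT => none; apply: nb.
have [zeta [alpha [zfin aP]]] := seq_enum F; exists zeta, alpha; split=> //.
  by move=> i iz; apply: FS; apply/aP; exists i.
exists y => // a [[Aa ax] nCa]; rewrite /below /= ltNge; apply/negP => ya.
apply: none; exists a; split=> // z /aP[i iz <-] Ca; apply: nCa.
by exists i.
Qed.

(** The guessed [x] is inaccessible, and clubs chosen at non-inaccessible limits do not accumulate
    there; so every culprit at [x] is inaccessible and carries its guessing club. *)
Lemma otimes_ladder : otimes (omega L) ->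
  exists2 C : L -> set L, ladder C & nontrivial_ladder C.
Proof.
move=> [Cg [clCg guess]].
pose R z D := (S_in L z -> D = Cg z) /\
  (~ S_in L z -> forall y, y < z -> limit_ordinal y -> S_in L y -> ~ cofinal_in D y).
have [z zl|C [ladC RC limC]] := @ladder_exists R.
  case: (pselect (S_in L z)) => Sz; first by exists (Cg z); split; [exact: clCg|].
  by have [D [clD DP]] := noninaccessible_club zl Sz; exists D.
exists C => // h.
have [x [[hx _] Sx _ nb]] := guess _ (club_closed_pt L_wo L_regular L_uncountable h).
exists x => // F FC y yx.
have FR z : z \in F -> S_in L z /\ C z = Cg z.
  move=> /FC zC; have [RC1 RC2] := RC _ (limC _ _ hx.1 zC).
  suff Sz : S_in L z by split=> //; exact: RC1.
  by apply: contrapT => /RC2 /(_ _ zC.1 hx.1 Sx zC.2).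
have [|a [ya ax [ha _] aF]] := unbounded_avoid nb (F := F) _ yx.
  by move=> z /FR[].
by exists a; split=> // z zF; rewrite (FR z zF).2; exact: aF.
Qed.

(** The guessing clubs cover all limits, and culprits at a limit are limits. *)
Lemma oplus_ladder : oplus (omega L) ->
  exists2 C : L -> set L, ladder C & nontrivial_ladder C.
Proof.
move=> [Cg [clCg guess]].
have [z zl|C [ladC RC limC]] := @ladder_exists (fun z D => D = Cg z).
  by exists (Cg z); split=> //; exact: clCg.
exists C => // h.
have [x [[hx _] _ nb]] := guess _ (club_closed_pt L_wo L_regular L_uncountable h).
exists x => // F FC y yx.
have Fl z : z \in F -> limit_ordinal z by move=> /FC; exact: limC hx.1.
have [a [ya ax [_ ha] aF]] := unbounded_avoid nb Fl yx.
by exists a; split=> // z zF; rewrite RC; [exact: aF | exact: Fl].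
Qed.

End Ladders.

(** * The colouring *)

Section Colouring.
Context {d : Order.disp_t} {L : orderType d}.
Context (L_wo : well_order (<=%O : rel L)).
Context (C : L -> set L).
Context (C_ladder : ladder C).
Local Open Scope order_scope.

(** The least number of steps of the walk; sets that are not pairs get colour 0. *)
Definition walk_colour (s : set L) : nat := xget 0%N [set n | exists i j,
  [/\ i < j, s = [set i; j], walk C i j n = i & forall m, walk C i j m = i -> (n <= m)%N]].

Lemma set2_lt_inj (i j i' j' : L) : i < j -> i' < j' -> [set i; j] = [set i'; j'] ->
  i = i' /\ j = j'.
Proof.
move=> ij ij' E.
have [ii'|ii'] : [set i'; j'] i by rewrite -E; left.
  split=> //; have [ji|//] : [set i'; j'] j by rewrite -E; right.
  by move: ij; rewrite ii' ji ltxx.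
have [ji|ji] : [set i'; j'] j by rewrite -E; right.
  by move: ij; rewrite ii' ji => /(lt_trans ij'); rewrite ltxx.
by move: ij; rewrite ii' ji ltxx.
Qed.

Lemma walk_colour_gt i j n : i < j -> walk C i j n <> i ->
  (n < walk_colour [set i; j])%N.
Proof.
move=> ij far; rewrite /walk_colour; set P := [set _ | _].
have /xgetPex-/(_ 0%N) : exists m, P m.
  have [m wm] := walk_reach L_wo C_ladder (ltW ij).
  have ex : exists m, walk C i j m == i by exists m; apply/eqP.
  exists (ex_minn ex); case: ex_minnP => k /eqP wk mink; exists i, j; split=> //.
  by move=> u /eqP; exact: mink.
move=> [i' [j' [ij' /set2_lt_inj[//|//|<- <-] wm _]]].
by rewrite ltnNge; apply/negP => mn; apply: far; apply: walk_stay mn wm.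
Qed.

End Colouring.

(** * Two-element sets and the two clauses *)

Lemma card_set2P (T : Type) (A : set T) :
  A #= [set: 'I_2] <-> exists x y, x <> y /\ A = [set x; y].
Proof.
rewrite -(card_eqr (card_II (n := 2))); split.
  move=> /eq_cardSP[x Ax /eq_cardSP[y [Ay yx]]].
  rewrite II0 card_eq0 => /eqP A0; exists x, y; split=> [/esym//|].
  apply/seteqP; split=> [z Az|z [->|->]//].
  apply: contrapT => nz; suff : set0 z by [].
  by rewrite -A0; split; [split=> // zx; apply: nz; left | move=> zy; apply: nz; right].
move=> [x [y [xy ->]]]; apply/eq_cardSP; exists x; first by left.
apply/eq_cardSP; exists y; first by split; [right | move=> /esym].
rewrite II0 card_eq0; apply/eqP/seteqP; split=> // z [[[]//]].
Qed.

Theorem mainTheorem2 (d : Order.disp_t) (L : orderType d)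
  (L_wo : well_order (<=%O : rel L))
  (L_regular : regular_cardinal [set: L])
  (L_uncountable : ~ countable [set: L])
  (L_hyp : ~ Mahlo L \/ (Mahlo L /\ (otimes (omega L) \/ oplus (omega L)))) :
  exists c : set L -> nat,
    (forall (A : set L) (n : nat), subsets_of_card [set: L] [set: L] A ->
       exists B : set L, subsets_of_card A [set: L] B /\
         exists m : nat, is_min (c @` subsets_of_card B [set: 'I_2]) m /\ n < m)
    /\
    (forall (w : L -> set L) (n : nat),
       (forall alpha, finite_set (w alpha)) ->
       (forall alpha beta, alpha <> beta -> w alpha `&` w beta = set0) ->
       exists X : set L, subsets_of_card [set: L] [set: L] X /\
         forall alpha beta, X alpha -> X beta -> (alpha < beta)%O ->
           forall i j, w alpha i -> w beta j -> n <= c [set i; j]).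
Proof.
have [C C_ladder C_nontrivial] : exists2 C : L -> set L, ladder C & nontrivial_ladder C.
  case: L_hyp => [|[_ [|]]]; [exact: nonMahlo_ladder | exact: otimes_ladder |].
  exact: oplus_ladder.
exists (walk_colour C); set c := walk_colour C.
have c_far (w : L -> set L) (n : nat) : (forall x, finite_set (w x)) ->
    (forall x y, x <> y -> w x `&` w y = set0) ->
    exists2 X : set L, X #= [set: L] & forall x y, X x -> X y -> (x < y)%O ->
      forall i j, w x i -> w y j -> n < c [set i; j].
  move=> w_fin w_disj.
  have /choice[s sP] : forall x, exists s : seq L, w x = [set` s].
    by move=> x; apply/finite_seqP.
  have [|X XL Xfar] :=
      far_homogeneous L_wo L_regular L_uncountable (w := s) C_ladder C_nontrivial _ n.
    move=> x y /w_disj xy i ix; apply/negP => iy; suff : set0 i by [].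
    by rewrite -xy !sP.
  exists X => // x y Xx Xy xy i j; rewrite !sP => ix jy.
  have [ij far] := Xfar _ _ Xx Xy xy _ _ ix jy.
  exact: walk_colour_gt.
split=> [A n [_ AL]|w n w_fin w_disj]; last first.
  have [X XL Xc] := c_far w n w_fin w_disj; exists X; split; first by split.
  by move=> x y Xx Xy xy i j ix jy; apply: ltnW; apply: Xc ix jy.
(* The first clause follows from the family of singletons [[set e x]], with [e] enumerating points
   of [A] injectively. *)
have [|e e_inj eA] := unbounded_enum L_wo L_regular (A := A).
  split=> // -[b _ sb]; apply: (@full_card _ _ L_regular b).
  by rewrite -(card_le_eql AL); exact: subset_card_le.
have [x|x y xy|X XL Xc] := c_far (fun x => [set e x]) n.
- exact: finite_set1.
- by apply/seteqP; split=> // _ [-> /e_inj].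
have BL : e @` X #= [set: L].
  by apply: card_eq_trans XL; apply: inj_card_eq => x y _ _ /e_inj.
have c_gt s : subsets_of_card (e @` X) [set: 'I_2] s -> n < c s.
  move=> [sB /card_set2P[i [j [ij sE]]]]; rewrite {}sE in sB *.
  have [x Xx xi] : (e @` X) i by apply: sB; left.
  have [y Xy yj] : (e @` X) j by apply: sB; right.
  case: (ltgtP x y) => xy; first exact: Xc xy _ _ (esym xi) (esym yj).
    by rewrite setUC; exact: Xc xy _ _ (esym yj) (esym xi).
  by case: ij; rewrite -xi -yj xy.
(* The minimum exists only if there is a pair: preimages of [o < q] under a surjection onto [L] are
   distinct. *)
have [s0 s0B] : exists s, subsets_of_card (e @` X) [set: 'I_2] s.
  have [o _] := point_exists L_uncountable; have [q oq] := exists_gt L_regular o.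
  have [g gP] : exists g : L -> L, [set: L] `<=` g @` (e @` X).
    by apply: card_le_cover => //; rewrite (card_le_eqr BL).
  have [[x Bx xo] [y By yq]] := (gP o I, gP q I).
  exists [set x; y]; split; first by move=> z [->|->].
  apply/card_set2P; exists x, y; split=> // xy.
  by move: oq; rewrite -xo -yq xy ltxx.
have ex : exists m, `[< (c @` subsets_of_card (e @` X) [set: 'I_2]) m >].
  by exists (c s0); apply/asboolP; exists s0.
exists (e @` X); split; first by split=> // _ [x _ <-].
exists (ex_minn ex); case: ex_minnP => m /asboolP mc minm; split.
  by split=> // k /asboolP /minm.
by have [s /c_gt + <-] := mc.
Qed.
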